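(* Let $(X,G)$ be a CR-dynamical system. Then the following hold. (1) $(X,G)$ is $1^{\omega}$-minimal if and only if $(X,G)$ is $1^{\oplus}$-minimal. (2) $(X,G)$ is $2^{\omega}$-minimal if and only if $(X,G)$ is $2^{\oplus}$-minimal. (3) If $(X,G)$ is $3^{\omega}$-minimal, then $(X,G)$ is $3^{\oplus}$-minimal.
   Context: A CR-dynamical system is a pair $(X,G)$ where $X$ is a compact metric space and $G\subseteq X\times X$ is a non-empty closed subset. Forward orbits: $\star_{i=1}^{\infty}G=\{(x_1,x_2,x_3,\ldots)\in\prod_{i=1}^\infty X : (x_i,x_{i+1})\in G \text{ for each positive integer } i\}$, and $\pi_k$ denotes the $k$-th coordinate projection. For $x\in X$, $T_G^{+}(x)=\{\mathbf x\in\star_{i=1}^{\infty}G : \pi_1(\mathbf x)=x\}$. For $\mathbf x\in\star_{i=1}^{\infty}G$, $\mathcal O_G^{\oplus}(\mathbf x)=\{\pi_k(\mathbf x): k\ge 1\}\subseteq X$. For $x\in X$, $\mathcal U_G^{\oplus}(x)=\bigcup_{\mathbf x\in T_G^{+}(x)}\mathcal O_G^{\oplus}(\mathbf x)$. $\mathrm{Cl}$ denotes closure in $X$. $(X,G)$ is $1^{\oplus}$-minimal if $T_G^{+}(x)\ne\emptyset$ for each $x\in X$ and $\mathrm{Cl}(\mathcal O_G^{\oplus}(\mathbf x))=X$ for each $\mathbf x\in\star_{i=1}^{\infty}G$; it is $2^{\oplus}$-minimal if for each $x\in X$ there is $\mathbf x\in T_G^{+}(x)$ with $\mathrm{Cl}(\mathcal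 O_G^{\oplus}(\mathbf x))=X$; it is $3^{\oplus}$-minimal if $\mathrm{Cl}(\mathcal U_G^{\oplus}(x))=X$ for each $x\in X$. Omega limit sets: for $\mathbf x\in\star_{i=1}^{\infty}G$, $\omega_G(\mathbf x)=\{x\in X : \text{there is a subsequence of the sequence } \mathbf x \text{ with limit } x\}$; for $x\in X$, $\psi_G(x)=\bigcup_{\mathbf x\in T_G^{+}(x)}\omega_G(\mathbf x)$. $(X,G)$ is $1^{\omega}$-minimal if $T_G^{+}(x)\neq\emptyset$ for each $x\in X$ and $\omega_G(\mathbf x)=X$ for each $\mathbf x\in\star_{i=1}^{\infty}G$; it is $2^{\omega}$-minimal if for each $x\in X$ there is $\mathbf x\in T_G^{+}(x)$ with $\omega_G(\mathbf x)=X$; it is $3^{\omega}$-minimal if $\psi_G(x)=X$ for each $x\in X$. *)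

(* Defs.v *)
From HB Require Import structures.
From mathcomp Require Import all_boot all_order all_algebra.
From mathcomp Require Import all_classical all_reals.
From mathcomp Require Import topology sequences.

Set Implicit Arguments.
Unset Strict Implicit.
Unset Printing Implicit Defensive.

Local Open Scope classical_set_scope.

Definition CR_dynamical_system (R : realType) (X : metricType R)
    (G : set (X * X)) : Prop :=
  [/\ compact [set: X], G !=set0 & closed G].

Section CR_dynamics.
Context {R : realType} {X : metricType R}.
Implicit Types (G : set (X * X)) (x : X) (u : nat -> X).

(* Sequences are indexed from 0: the k-th coordinate, k >= 1, is u k.-1. *)

Definition star G : set (nat -> X) :=
  [set u | forall i : nat, G (u i, u i.+1)].

Definition forward_trajectories G x : set (nat -> X) :=
  [set u | star G u /\ u 0%N = x].

Definition forward_orbit u : set X := range u.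

Definition forward_reach G x : set X :=
  \bigcup_(u in forward_trajectories G x) forward_orbit u.

Definition omega_limit u : set X :=
  [set p | exists2 f : nat -> nat, increasing_seq f & (u \o f) @ \oo --> p].

Definition omega_reach G x : set X :=
  \bigcup_(u in forward_trajectories G x) omega_limit u.

Definition oplus_minimal1 G : Prop :=
  (forall x, forward_trajectories G x !=set0) /\
  (forall u, star G u -> closure (forward_orbit u) = [set: X]).

Definition oplus_minimal2 G : Prop :=
  forall x, exists2 u, forward_trajectories G x u &
    closure (forward_orbit u) = [set: X].

Definition oplus_minimal3 G : Prop :=
  forall x, closure (forward_reach G x) = [set: X].

Definition omega_minimal1 G : Prop :=
  (forall x, forward_trajectories G x !=set0) /\
  (forall u, star G u -> omega_limit u = [set: X]).

Definition omega_minimal2 G : Prop :=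
  forall x, exists2 u, forward_trajectories G x u &
    omega_limit u = [set: X].

Definition omega_minimal3 G : Prop :=
  forall x, omega_reach G x = [set: X].

End CR_dynamics.

(* Main.v *)
Require Import Defs.
From mathcomp Require Import all_boot all_order all_algebra.
From mathcomp Require Import all_classical all_reals.
From mathcomp Require Import topology sequences.
From mathcomp Require Import interval_inference num_normedtype.
From mathcomp Require Import zify.

(** A point is a limit of a subsequence iff each of its neighbourhoods is
    visited infinitely often. If all trajectories are dense then so are all
    tails, since tails are trajectories; this gives the first equivalence. For
    the second one, a single dense trajectory may visit an isolated point only
    finitely often, so its omega limit set can be too small. Instead, follow a
    dense trajectory from the starting point until it is 1-dense (finitely many
    steps suffice, by compactness), then switch to a dense trajectory starting
    at the current point until that one is 1/2-dense, and so on. *)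

Local Open Scope classical_set_scope.
Local Open Scope ring_scope.
Import Order.TTheory GRing.Theory Num.Theory.

Section omega_limit_sets.
Set Implicit Arguments.
Unset Strict Implicit.
Context {R : realType} {X : metricType R}.
Implicit Types (G : set (X * X)) (x p : X) (u v : nat -> X).

Lemma omega_limitP u p : omega_limit u p <->
  forall e : R, 0 < e -> forall m, exists2 n, (m <= n)%N & ball p e (u n).
Proof.
split=> [[f f_incr /cvg_ballP ufp] e e0 m|visits].
  have [N _ fN] := ufp e e0; exists (f (maxn m N)); last first.
    exact: fN (leq_maxr _ _).
  have f_ge n : (n <= f n)%N.
    elim: n => // n IHn; apply: leq_ltn_trans IHn _.
    by move/increasing_seqP: f_incr => /(_ n).
  exact: leq_trans (leq_maxl _ _) (f_ge _).
have inv_gt0 (n : nat) : 0 < n.+1%:R^-1 :> R by rewrite invr_gt0 ltr0Sn.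
have next (c : nat * nat) :
    {n | (c.1 <= n)%N & ball p c.2.+1%:R^-1 (u n)}.
  by apply: cid2; exact: visits.
(* Each visit is sought strictly after the previous one, so [f] increases, and the [n]-th radius is
   [1 / (n + 1)], so the visits converge to [p]. *)
pose f := fix f n := if n is n'.+1 then s2val (next ((f n').+1, n))
                     else s2val (next (0%N, 0%N)).
have f_ball n : ball p n.+1%:R^-1 (u (f n)).
  by case: n => [|n] /=; case: (next _).
exists f.
  by apply/increasing_seqP => n; rewrite /=; case: (next _).
apply/cvg_ballP => e e0; near=> n.
apply: (le_ball _ (f_ball n)); apply: ltW; near: n.
exact: (near_infty_natSinv_lt (PosNum e0)).
Unshelve. all: by end_near. Qed.

Lemma dense_orbitP u : closure (forward_orbit u) = [set: X] <->
  forall p (e : R), 0 < e -> exists n, ball p e (u n).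
Proof.
split=> [dense p e e0|visits].
  have : closure (forward_orbit u) p by rewrite dense.
  by move=> /(_ _ (nbhsx_ballx p e e0)) [_ [[n _ <-] pun]]; exists n.
rewrite -subTset => p _ B /nbhs_ballP[e /= e0 peB].
by have [n /peB Bun] := visits p e e0; exists (u n); split=> //; exists n.
Qed.

Lemma omega_limit_sub_closure u : omega_limit u `<=` closure (forward_orbit u).
Proof.
move=> p /omega_limitP visits B /nbhs_ballP[e /= e0 peB].
have [n _ /peB Bun] := visits e e0 0%N.
by exists (u n); split=> //; exists n.
Qed.

Lemma star_shift G u m : star G u -> star G (fun n => u (m + n)%N).
Proof. by move=> Gu n; rewrite addnS; exact: Gu. Qed.

(* [0 < i] ensures that every stage of [concat] below takes time. *)
Definition dense_upto (e : R) v (i : nat) : Prop :=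
  (0 < i)%N /\ forall p, exists2 j, (j <= i)%N & ball p e (v j).

Lemma dense_uptoW e v i j : (i <= j)%N -> dense_upto e v i -> dense_upto e v j.
Proof.
move=> ij [i0 vi]; split=> [|p]; first exact: leq_trans ij.
by have [k ki pvk] := vi p; exists k => //; exact: leq_trans ij.
Qed.

Lemma dense_orbit_dense_upto (e : R) v : compact [set: X] -> 0 < e ->
  closure (forward_orbit v) = [set: X] -> exists i, dense_upto e v i.
Proof.
move=> cptX e0 /dense_orbitP dense_v.
have e20 : 0 < e / 2 by rewrite divr_gt0.
(* Near-covering form of compactness: a time bound valid locally around each point yields one valid
   on all of [X]. Halving the radius lets one visit serve a whole ball. *)
have [|N _ NP] := (compact_near_coveringP _).1 cptX nat \oo
  (fun i p => exists2 j, (j <= i)%N & ball p e (v j)).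
  move=> p _; have [j pvj] := dense_v p _ e20.
  exists (ball p (e / 2), [set i | (j <= i)%N]).
    by split; [exact: nbhsx_ballx|exists j].
  move=> [q i] /= [pq ji]; exists j => //.
  exact: ball_splitr pq pvj.
exists N.+1; split=> // p; exact: NP (leqnSn N) p I.
Qed.

Section concatenation.
Variable D : X -> nat -> X.

(* The state [(x, i, k)] is at position [i] of the trajectory [D x], which is
   followed until it is [1 / (k + 1)]-dense. *)
Definition concat_step (s : X * nat * nat) : X * nat * nat :=
  let: (x, i, k) := s in
  if `[< dense_upto k.+1%:R^-1 (D x) i >] then (D x i, 1%N, k.+1)
  else (x, i.+1, k).

Definition concat_state x n := iter n concat_step (x, 0%N, 0%N).

Definition concat x n := let: (y, i, _) := concat_state x n in D y i.

Hypothesis D0 : forall x, D x 0%N = x.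

Lemma concat0 x : concat x 0%N = x.
Proof. exact: D0. Qed.

(** At a switch the current point [D y i] is also [D (D y i) 0], so [D (D y i) 1] may follow it;
    hence a new stage enters at position 1. *)
Lemma concat_star G x : (forall y, star G (D y)) -> star G (concat x).
Proof.
move=> DG n; rewrite /concat /concat_state iterS.
case: (iter n _ _) => -[y i] k /=; case: ifP => _; last exact: DG.
by have := DG (D y i) 0%N; rewrite D0.
Qed.

(** The witness [t] is the time at which the current stage starts. Every completed stage lasts at
    least one step, so late stages start late. *)
Lemma concat_stateP x n y i k : concat_state x n = (y, i, k) ->
  exists t, [/\ n = (t + i)%N, (k <= t.+1)%N &
    forall j, (j <= i)%N -> concat x (t + j)%N = D y j].
Proof.
elim: n y i k => [|n IHn] y i k.
  move=> [<- <- <-]; exists 0%N; split=> // j.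
  by rewrite leqn0 => /eqP ->.
move=> state_n1; move: (state_n1); rewrite /concat_state iterS -/(concat_state x n).
case state_n: (concat_state x n) => [[z l] m] /=.
have [t [nE mt tP]] := IHn _ _ _ state_n.
case: asboolP => [[l0 _]|_] [yE iE kE]; subst y i k; last first.
  exists t; split=> // [|j]; first by rewrite addnS nE.
  rewrite leq_eqVlt => /orP[/eqP ->|]; last exact: tP.
  by rewrite addnS -nE /concat state_n1.
(* The new stage starts at time [n], at the point it shares with the old one. *)
exists n; split=> [||[|[|//]] _]; first by rewrite addn1.
- by rewrite nE; lia.
- by rewrite addn0 nE tP // D0.
- by rewrite addn1 /concat state_n1.
Qed.

Hypothesis Dlong : forall (e : R) x, 0 < e -> exists i, dense_upto e (D x) i.

Lemma concat_stage_end x n y i k : concat_state x n = (y, i, k) ->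
  exists n' i', concat_state x n' = (y, i', k) /\
    dense_upto k.+1%:R^-1 (D y) i'.
Proof.
move=> state_n.
have k0 : 0 < k.+1%:R^-1 :> R by rewrite invr_gt0 ltr0Sn.
have : exists m, `[< dense_upto k.+1%:R^-1 (D y) (i + m) >].
  have [N DN] := Dlong y k0; exists N; apply/asboolP.
  exact: dense_uptoW (leq_addl _ _) DN.
case/ex_minnP => m /asboolP m_end m_min; exists (m + n)%N, (i + m)%N; split=> //.
(* Generalised to [j <= m] for the induction: by minimality of [m] the density test fails before
   [i + m], so only the position advances. *)
have : (m <= m)%N by [].
elim: {1 3 4}m => [|j IHj] jm; first by rewrite add0n addn0.
rewrite addSn /concat_state iterS -/(concat_state x (j + n)) IHj ?(ltnW jm) //=.
rewrite ifF ?addnS //; apply/negP => /m_min; lia.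
Qed.

Lemma concat_stage x k : exists n y i, concat_state x n = (y, i, k).
Proof.
elim: k => [|k [n [y [i]]]]; first by exists 0%N, x, 0%N.
case/concat_stage_end => n' [i' [state_n' i'_end]].
exists n'.+1, (D y i'), 1%N.
rewrite /concat_state iterS -/(concat_state x n') state_n' /=.
by rewrite (asboolT i'_end).
Qed.

Lemma omega_limit_concat x : omega_limit (concat x) = [set: X].
Proof.
rewrite -subTset => p _; apply/omega_limitP => e e0 m.
have [N _ NP] := near_infty_natSinv_lt (PosNum e0).
(* Exceeding [m] makes the stage start no earlier than time [m]; exceeding [N] makes its density
   radius smaller than [e]. *)
have [n [y [i]]] := concat_stage x (maxn m N).+1.
case/concat_stage_end => n' [i' [/concat_stateP[t [_ kt tP]] [_ i'_dense]]].
have [j ji' pj] := i'_dense p; exists (t + j)%N.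
  by move: kt; rewrite ltnS; have := leq_maxl m N; lia.
rewrite tP //; apply: le_ball pj; apply: ltW; apply: NP => /=.
exact: leqW (leq_maxr _ _).
Qed.

End concatenation.

Lemma oplus_minimal1_omega G : oplus_minimal1 G -> omega_minimal1 G.
Proof.
move=> [nonempty dense]; split=> // u Gu.
rewrite -subTset => p _; apply/omega_limitP => e e0 m.
have [n pn] := (dense_orbitP _).1 (dense _ (star_shift m Gu)) p e e0.
by exists (m + n)%N => //; exact: leq_addr.
Qed.

Lemma oplus_minimal2_omega G : compact [set: X] ->
  oplus_minimal2 G -> omega_minimal2 G.
Proof.
move=> cptX dense x.
pose D y := s2val (cid2 (dense y)).
have DT y : forward_trajectories G y (D y) by exact: (s2valP (cid2 (dense y))).
have D0 y : D y 0%N = y by have [] := DT y.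
exists (concat D x).
  by split; [apply: concat_star => // y; have [] := DT y|exact: concat0].
apply: omega_limit_concat => // e y e0.
exact: dense_orbit_dense_upto (s2valP' (cid2 (dense y))).
Qed.

End omega_limit_sets.

Theorem theorem5p9 (R : realType) (X : metricType R) (G : set (X * X))
    (hG : CR_dynamical_system G) :
  [/\ omega_minimal1 G <-> oplus_minimal1 G,
      omega_minimal2 G <-> oplus_minimal2 G
    & omega_minimal3 G -> oplus_minimal3 G].
Proof.
have [cptX _ _] := hG.
have dense u : omega_limit u = [set: X] ->
    closure (forward_orbit u) = [set: X].
  by move=> uT; rewrite -subTset -uT; exact: omega_limit_sub_closure.
split; first split.
- by move=> [nonempty omegaT]; split=> // u /omegaT /dense.
- exact: oplus_minimal1_omega.
- split; last exact: oplus_minimal2_omega.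
  by move=> omegaT x; have [u xu /dense] := omegaT x; exists u.
move=> omegaT x; rewrite -subTset -(omegaT x) => p [u xu up].
apply: closure_subset (omega_limit_sub_closure up).
by move=> q uq; exists u.
Qed.
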